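(* Let $d(k)$ denote the number of positive divisors of the positive integer $k$ and let $\gamma$ be Euler's constant. For all real $q\in(0,1)$, $$-\gamma\,\frac{q\log(1-q)}{1-q}-\frac{\log^2(1-q)}{\log(q)}<\sum_{k=2}^\infty\sum_{j=1}^{k-1}\frac{d(j)}{k-j}\,q^k<-\frac{q\log(1-q)}{1-q}-\frac{\log^2(1-q)}{\log(q)}.$$ Moreover the constants are best possible: if $\lambda_0,\mu_0$ are real constants such that $\lambda_0\frac{q\log(1-q)}{1-q}-\frac{\log^2(1-q)}{\log(q)}<\sum_{k=2}^\infty\sum_{j=1}^{k-1}\frac{d(j)}{k-j}q^k<\mu_0\frac{q\log(1-q)}{1-q}-\frac{\log^2(1-q)}{\log(q)}$ for all $q\in(0,1)$, then $\lambda_0\ge-\gamma$ and $\mu_0\le-1$.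
   Context: $\log$ denotes the natural logarithm. *)

(* Defs.v *)
From Stdlib Require Import Reals Lra Lia Arith List.
From Coquelicot Require Import Coquelicot.
Open Scope R_scope.

Definition num_divisors (k : nat) : nat :=
  length (filter (fun i => (k mod i =? 0)%nat) (seq 1 k)).

Definition euler_gamma : R :=
  real (Lim_seq (fun n => sum_n_m (fun k => / INR k) 1 n - ln (INR n))).

(* [Lim_seq] and the projection [real] are total; this certifies that
   [euler_gamma] is a genuine finite limit. *)
Lemma is_lim_seq_euler_gamma :
  is_lim_seq (fun n => sum_n_m (fun k => / INR k) 1 n - ln (INR n)) euler_gamma.
Proof.
  assert (Hln : forall x, 0 < x -> ln x <= x - 1).
  { intros x Hx. destruct (Rle_lt_dec (ln x) (x - 1)) as [H|H]; [exact H|].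
    apply exp_increasing in H. rewrite exp_ln in H by exact Hx.
    pose proof (exp_ineq1_le (x - 1)). lra. }
  assert (Hpos : forall n, 0 < INR (S n)) by (intro n; apply lt_0_INR; lia).
  assert (Hup : forall n, ln (INR (S (S n))) - ln (INR (S n)) <= / INR (S n)).
  { intro n. pose proof (Hpos n). pose proof (Hpos (S n)).
    rewrite <- ln_div by assumption.
    eapply Rle_trans; [apply Hln, Rdiv_lt_0_compat; assumption|].
    rewrite (S_INR (S n)). right. field. lra. }
  assert (Hlow : forall n, / INR (S (S n)) <= ln (INR (S (S n))) - ln (INR (S n))).
  { intro n. pose proof (Hpos n). pose proof (Hpos (S n)).
    assert (E : ln (INR (S n) / INR (S (S n))) <= INR (S n) / INR (S (S n)) - 1)
      by (apply Hln, Rdiv_lt_0_compat; assumption).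
    rewrite ln_div in E by assumption.
    replace (INR (S n) / INR (S (S n)) - 1) with (- / INR (S (S n))) in E
      by (rewrite (S_INR (S n)) in *; field; lra).
    lra. }
  apply Lim_seq_correct'.
  enough (ex_finite_lim_seq
            (fun n => sum_n_m (fun k => / INR k) 1 (S n) - ln (INR (S n))))
    as [l Hl].
  { exists l. apply is_lim_seq_incr_1, Hl. }
  apply ex_finite_lim_seq_decr with 0.
  - intro n. rewrite (sum_n_Sm _ 1 (S n)) by lia.
    pose proof (Hlow n).
    change (sum_n_m (fun k => / INR k) 1 (S n) + / INR (S (S n))
            - ln (INR (S (S n)))
            <= sum_n_m (fun k => / INR k) 1 (S n) - ln (INR (S n))).
    lra.
  - intro n.
    enough (ln (INR (S (S n))) <= sum_n_m (fun k => / INR k) 1 (S n)).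
    { assert (ln (INR (S n)) <= ln (INR (S (S n)))).
      { apply ln_le; [apply Hpos|apply le_INR; lia]. }
      lra. }
    induction n as [|n IH].
    + rewrite sum_n_n. pose proof (Hup 0%nat) as H0.
      change (INR 1) with 1 in H0 |- *. rewrite ln_1 in H0. lra.
    + rewrite (sum_n_Sm _ 1 (S n)) by lia.
      change (ln (INR (S (S (S n))))
              <= sum_n_m (fun k => / INR k) 1 (S n) + / INR (S (S n))).
      pose proof (Hup (S n)). lra.
Qed.

(* The term of index [n] is the one with [k = n + 2], so that the series starts
   at [k = 2]. *)
Definition double_sum_term (q : R) (n : nat) : R :=
  let k := (n + 2)%nat in
  sum_n_m (fun j => INR (num_divisors j) / INR (k - j) * q ^ k) 1 (k - 1).

Definition log_bound (c q : R) : R :=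
  c * (q * ln (1 - q) / (1 - q)) - (ln (1 - q)) ^ 2 / ln q.

(* Main.v *)
(* With [ln (1 - q) = - sum q^n / n] and the Lambert series [L q = sum d(n) q^n = sum q^n / (1 - q^n)],
   the double sum is [- ln (1 - q) * L q], and the bounds become [gamma < gap q < 1] for
   [gap q = (1 - q) / q * (L q - ln (1 - q) / ln q)].
   Writing [t = - ln q] and [h u = 1 / (1 - exp (- u)) - 1 / u], one finds
   [gap q = sum_{n >= 0} (q^n - q^(n+1)) h ((n+1) t)], a weighted mean of values of [h], which
   increases from 1/2 to 1. Hence [gap q < 1], and [gap q -> 1] as [q -> 0].
   As [h] increases, grouping terms in pairs gives [gap r < gap (r^2)]; thus [gap q] exceeds the limit
   of [gap] along [q^(1/2^k)]. Comparing [L q] with the telescoping differences of [ln (1 - q^n)]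
   identifies the limit of [gap] at 1 as the limit of [1 + ... + 1/N - ln (N+1)], that is, gamma. *)
Require Import Defs.
From Stdlib Require Import Reals Lra Lia Arith List.
From Coquelicot Require Import Coquelicot.
Open Scope R_scope.

(* Coquelicot states equations in the carrier of an algebraic structure, which [ring] and [field]
   do not recognise as [R]. *)
Ltac as_real_eq := match goal with |- @eq _ ?a ?b => change (@eq R a b) end.

(** * Elementary bounds for [exp], [ln] and powers *)

Lemma exp_neg_interval (u : R) : 0 < u -> 0 < exp (- u) < 1.
Proof.
  intros Hu. split; [apply exp_pos|].
  rewrite <- exp_0. apply exp_increasing. lra.
Qed.

Lemma ln_neg_of_lt_1 (q : R) : 0 < q < 1 -> ln q < 0.
Proof. intros Hq. rewrite <- ln_1. apply ln_increasing; lra. Qed.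

Lemma ln_le_sub_1 (x : R) : 0 < x -> ln x <= x - 1.
Proof.
  intros Hx. pose proof (exp_ineq1_le (ln x)) as H.
  rewrite exp_ln in H by assumption. lra.
Qed.

Lemma ln_ge_1_sub_inv (x : R) : 0 < x -> 1 - / x <= ln x.
Proof.
  intros Hx. pose proof (ln_le_sub_1 (/ x) (Rinv_0_lt_compat _ Hx)) as H.
  rewrite ln_Rinv in H by assumption. lra.
Qed.

Lemma pow_lt_1 (q : R) (n : nat) : 0 < q < 1 -> 0 < q ^ S n < 1.
Proof.
  intros Hq. split; [apply pow_lt; lra|].
  apply pow_lt_1_compat; [lra|lia].
Qed.

Lemma pow_le_1 (q : R) (n : nat) : 0 < q < 1 -> 0 < q ^ n <= 1.
Proof.
  intros Hq. split; [apply pow_lt; lra|].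
  destruct n as [|n]; [simpl; lra|]. pose proof (pow_lt_1 q n Hq). lra.
Qed.

(** * Range and monotonicity of the function h *)

Definition bose (u : R) : R := / (1 - exp (- u)) - / u.

(** Clearing denominators turns this into [1 + u < exp u]. *)
Lemma bose_lt_1 (u : R) : 0 < u -> bose u < 1.
Proof.
  intros Hu. unfold bose. pose proof (exp_neg_interval u Hu) as He.
  pose proof (exp_ineq1 u ltac:(lra)) as H.
  assert (E : exp u * exp (- u) = 1) by (rewrite <- exp_plus, Rplus_opp_r; apply exp_0).
  assert (H' : (1 + u) * exp (- u) < 1) by (rewrite <- E; apply Rmult_lt_compat_r; lra).
  assert (/ (1 - exp (- u)) < 1 + / u); [|lra].
  replace (1 + / u) with (/ (u / (1 + u))) by (field; lra).
  apply Rinv_lt_contravar.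
  - apply Rmult_lt_0_compat; [apply Rdiv_lt_0_compat|]; lra.
  - apply Rmult_lt_reg_r with (1 + u); [lra|].
    replace (u / (1 + u) * (1 + u)) with u by (field; lra). lra.
Qed.

Lemma bose_pos (u : R) : 0 < u -> 0 < bose u.
Proof.
  intros Hu. unfold bose. pose proof (exp_neg_interval u Hu) as He.
  pose proof (exp_ineq1 (- u) ltac:(lra)) as H.
  assert (/ u < / (1 - exp (- u))); [|lra].
  apply Rinv_lt_contravar; [apply Rmult_lt_0_compat|]; lra.
Qed.

(** Positivity is asked only inside the interval because in [two_sinh_gt] the derivative vanishes at
    the left end 0. *)
Lemma increasing_of_derive_pos (f df : R -> R) (a b : R) :
  a < b -> (forall x, a <= x <= b -> is_derive f x (df x)) ->
  (forall x, a < x < b -> 0 < df x) -> f a < f b.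
Proof.
  intros Hab Hd Hpos.
  destruct (MVT_cor2 f df a b Hab) as [c [E Hc]].
  - intros x Hx. apply is_derive_Reals, Hd, Hx.
  - pose proof (Rmult_lt_0_compat _ _ (Hpos c Hc) (proj2 (Rlt_0_minus _ _) Hab)). lra.
Qed.

Lemma two_sinh_gt (x : R) : 0 < x -> 2 * x < exp x - exp (- x).
Proof.
  intros Hx.
  enough (exp 0 - exp (- 0) - 2 * 0 < exp x - exp (- x) - 2 * x)
    by (rewrite Ropp_0 in *; lra).
  apply (increasing_of_derive_pos (fun y => exp y - exp (- y) - 2 * y)
           (fun y => exp y + exp (- y) - 2)).
  - exact Hx.
  - intros y _. auto_derive; [exact I|]. ring.
  - intros y Hy.
    (* AM-GM: two distinct positive numbers with product 1 have sum greater than 2. *)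
    assert (E : exp y * exp (- y) = 1) by (rewrite <- exp_plus, Rplus_opp_r; apply exp_0).
    pose proof (exp_neg_interval y ltac:(lra)). pose proof (exp_ineq1 y ltac:(lra)).
    nra.
Qed.

(** The derivative is [1 / x^2 - 1 / (2 sinh (x/2))^2], which is positive by [two_sinh_gt]. *)
Lemma bose_increasing (u v : R) : 0 < u -> u < v -> bose u < bose v.
Proof.
  intros Hu Huv.
  apply (increasing_of_derive_pos bose
           (fun x => / x ^ 2 - exp (- x) / (1 - exp (- x)) ^ 2)); [assumption| |].
  - intros x Hx. pose proof (exp_neg_interval x ltac:(lra)).
    unfold bose. auto_derive; [lra|]. field. lra.
  - intros x Hx. pose proof (exp_neg_interval x ltac:(lra)) as He.
    (* [x < 2 sinh (x/2)] squared *)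
    pose proof (two_sinh_gt (x / 2) ltac:(lra)) as Hs.
    assert (E : exp (- x) = exp (- (x / 2)) * exp (- (x / 2)))
      by (rewrite <- exp_plus; f_equal; lra).
    assert (E' : exp (x / 2) * exp (- (x / 2)) = 1)
      by (rewrite <- exp_plus, Rplus_opp_r; apply exp_0).
    pose proof (exp_pos (- (x / 2))) as Hp.
    assert (Hlt : x * exp (- (x / 2)) < 1 - exp (- x)) by nra.
    replace (/ x ^ 2 - exp (- x) / (1 - exp (- x)) ^ 2)
      with (((1 - exp (- x)) ^ 2 - (x * exp (- (x / 2))) ^ 2)
            / (x ^ 2 * (1 - exp (- x)) ^ 2))
      by (rewrite Rpow_mult_distr, E; field; rewrite <- E; lra).
    apply Rdiv_lt_0_compat.
    + assert (0 < x * exp (- (x / 2))) by (apply Rmult_lt_0_compat; lra). nra.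
    + apply Rmult_lt_0_compat; apply pow_lt; lra.
Qed.

(** * The logarithm series and a vanishing error term *)

(* The error of the truncated series has derivative [x ^ S N / (1 - x)]. *)
Lemma is_series_neg_ln (q : R) :
  0 < q < 1 -> is_series (fun n => q ^ S n / INR (S n)) (- ln (1 - q)).
Proof.
  intros Hq.
  assert (Hd : forall N x, x < 1 ->
    is_derive (fun y => - ln (1 - y) - sum_n (fun n => y ^ S n / INR (S n)) N) x
      (x ^ S N / (1 - x))).
  { intros N x Hx. induction N as [|N IH].
    - apply (is_derive_ext (fun y => - ln (1 - y) - y)).
      { intro t. rewrite sum_O. simpl. field. }
      auto_derive; [lra|]. field. lra.
    - apply (is_derive_ext
        (fun y => - ln (1 - y) - sum_n (fun n => y ^ S n / INR (S n)) N
                  - y ^ S (S N) / INR (S (S N)))).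
      { intro t. rewrite sum_Sn. unfold plus. cbn -[INR pow sum_n]. ring. }
      replace (x ^ S (S N) / (1 - x)) with (x ^ S N / (1 - x) - x ^ S N).
      2:{ rewrite <- (tech_pow_Rmult x (S N)). field. lra. }
      apply @is_derive_minus; [exact IH|].
      pose proof (lt_0_INR (S (S N)) ltac:(lia)).
      auto_derive; [exact I|]. 
      change (1 * (INR (S (S N)) * x ^ S N) * / INR (S (S N)) = x ^ S N). field. lra. }
  assert (Hb : forall N,
    0 <= - ln (1 - q) - sum_n (fun n => q ^ S n / INR (S n)) N <= q * (/ (1 - q)) * q ^ S N).
  { intro N.
    (* The error vanishes at 0, so at [q] it equals [q * c ^ S N / (1 - c)] for some [c] in
       [(0, q)]. *)
    destruct (MVT_cor2 _ _ 0 q ltac:(lra)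
      (fun x Hx => proj1 (is_derive_Reals _ x _) (Hd N x ltac:(lra)))) as [c [E Hc]].
    cbv beta in E. rewrite Rminus_0_r, ln_1 in E.
    assert (E0 : sum_n (fun n => 0 ^ S n / INR (S n)) N = 0).
    { rewrite (sum_n_ext _ (fun _ => 0)).
      - rewrite sum_n_const. apply Rmult_0_r.
      - intro n. unfold Rdiv. rewrite pow_i by lia. apply Rmult_0_l. }
    rewrite E0 in E.
    assert (c ^ S N <= q ^ S N) by (apply pow_incr; lra).
    assert (0 < c ^ S N) by (apply pow_lt; lra).
    assert (0 < / (1 - c) <= / (1 - q)).
    { split; [apply Rinv_0_lt_compat; lra|]. apply Rinv_le_contravar; lra. }
    replace (- ln (1 - q) - sum_n (fun n => q ^ S n / INR (S n)) N)
      with (q * (/ (1 - c)) * c ^ S N) by (unfold Rdiv in E; lra).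
    split; [apply Rmult_le_pos; nra|].
    apply Rmult_le_compat; nra. }
  assert (Hg : is_lim_seq (fun N => q ^ S N) 0).
  { apply (is_lim_seq_incr_1 (fun n => q ^ n)), is_lim_seq_geom.
    rewrite Rabs_pos_eq; lra. }
  change (is_lim_seq (sum_n (fun n => q ^ S n / INR (S n))) (- ln (1 - q))).
  apply (is_lim_seq_le_le (fun N => - ln (1 - q) - q * (/ (1 - q)) * q ^ S N) _
           (fun _ => - ln (1 - q))).
  - intro N. specialize (Hb N). lra.
  - replace (- ln (1 - q)) with (- ln (1 - q) - q * (/ (1 - q)) * 0) at 1 by ring.
    apply is_lim_seq_minus'; [apply is_lim_seq_const|].
    apply (is_lim_seq_scal_l (fun N => q ^ S N) _ 0), Hg.
  - apply is_lim_seq_const.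
Qed.

(** The quotient [(1 - q ^ S N) / (1 - q)] is a sum of [S N] powers of [q], each at least
    [q ^ N]. *)
Lemma pow_mult_succ_le (q : R) (N : nat) :
  0 < q < 1 -> INR (S N) * q ^ N * (1 - q) <= 1 - q ^ S N.
Proof.
  intros Hq. induction N as [|N IH]; [simpl; lra|].
  rewrite (S_INR (S N)). pose proof (pow_lt_1 q N Hq) as Hp.
  cbn -[INR] in *. nra.
Qed.

(** With [r = sqrt q], one factor [r ^ S N] absorbs [S N] at the cost of the constant [1 / (1 - r)],
    by [pow_mult_succ_le]; the other tends to 0. *)
Lemma is_lim_seq_succ_mult_pow (q : R) :
  0 < q < 1 -> is_lim_seq (fun N => INR (S N) * q ^ S N) 0.
Proof.
  intros Hq. set (r := sqrt q).
  assert (Hr : 0 < r < 1).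
  { split; [apply sqrt_lt_R0; lra|]. rewrite <- sqrt_1. apply sqrt_lt_1; lra. }
  assert (E : q = r * r) by (unfold r; rewrite sqrt_def; lra).
  assert (Hg : is_lim_seq (fun N => / (1 - r) * r ^ S N) 0).
  { replace (Finite 0) with (Finite (/ (1 - r) * 0)) by (f_equal; ring).
    apply (is_lim_seq_scal_l (fun N => r ^ S N) _ 0).
    apply (is_lim_seq_incr_1 (fun n => r ^ n)), is_lim_seq_geom.
    rewrite Rabs_pos_eq; lra. }
  apply (is_lim_seq_le_le (fun _ => 0) _ (fun N => / (1 - r) * r ^ S N)).
  - intro N. pose proof (pow_lt_1 r N Hr). pose proof (pow_lt_1 q N Hq).
    pose proof (pow_mult_succ_le r N Hr). pose proof (pow_le_1 r N Hr).
    pose proof (pos_INR (S N)). split; [nra|].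
    apply Rmult_le_reg_r with (1 - r); [lra|].
    replace (/ (1 - r) * r ^ S N * (1 - r)) with (r ^ S N) by (field; lra).
    rewrite E, Rpow_mult_distr.
    replace (INR (S N) * (r ^ S N * r ^ S N) * (1 - r))
      with (r ^ S N * r * (INR (S N) * r ^ N * (1 - r))) by (cbn -[INR]; ring).
    rewrite <- (Rmult_1_r (r ^ S N)) at 2.
    apply Rmult_le_compat; [nra| |nra|lra].
    apply Rmult_le_pos; [apply Rmult_le_pos|]; lra.
  - apply is_lim_seq_const.
  - exact Hg.
Qed.

(** * Divisor sums and the Lambert series *)

Lemma length_filter_seq (p : nat -> bool) (a n : nat) :
  INR (length (filter p (seq a (S n))))
  = sum_n (fun i => if p (a + i)%nat then 1 else 0) n.
Proof.
  induction n as [|n IH].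
  - rewrite sum_O, Nat.add_0_r. simpl. destruct (p a); reflexivity.
  - rewrite sum_Sn, <- IH, (seq_S (S n)), filter_app, length_app, plus_INR.
    simpl filter at 2. destruct (p (a + S n)%nat); reflexivity.
Qed.

(** Indices [i > j] contribute nothing, since then [S j mod S i = S j] is nonzero. An upper limit
    independent of [j] makes the later exchange of sums possible. *)
Lemma num_divisors_sum (j N : nat) : (j <= N)%nat ->
  INR (num_divisors (S j))
  = sum_n (fun i => if (S j mod S i =? 0)%nat then 1 else 0) N.
Proof.
  intros H. unfold num_divisors.
  rewrite (length_filter_seq (fun i => (S j mod i =? 0)%nat)).
  induction H as [|N H IH]; [reflexivity|].
  rewrite sum_Sn, <- IH, Nat.mod_small by lia. symmetry. apply Rplus_0_r.
Qed.

(** A finite geometric sum over the multiples of [S n] up to [S N]; the exponent subtracted is the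
    first multiple beyond [S N]. *)
Lemma sum_multiples_pow (q : R) (n N : nat) : 0 < q < 1 ->
  sum_n (fun j => if (S j mod S n =? 0)%nat then q ^ S j else 0) N
  = (q ^ S n - q ^ (S n * (S N / S n + 1))) / (1 - q ^ S n).
Proof.
  intros Hq. pose proof (pow_lt_1 q n Hq) as Hp.
  (* Telescoping: passing from [M] to [S M] raises the quotient by [S n] exactly when [S n] divides
     [S M]. *)
  assert (Hstep : forall M, (if (S M mod S n =? 0)%nat then q ^ S M else 0)
    = (q ^ (S n * (M / S n + 1)) - q ^ (S n * (S M / S n + 1))) / (1 - q ^ S n)).
  { intro M. pose proof (Nat.div_mod_eq (S M) (S n)) as E.
    pose proof (Nat.mod_upper_bound (S M) (S n) ltac:(lia)) as Hr.
    set (k := (S M / S n)%nat) in *.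
    destruct (Nat.eqb_spec (S M mod S n) 0) as [H0|H0].
    - rewrite H0 in E. destruct k as [|k]; [lia|].
      rewrite <- (Nat.div_unique M (S n) k n) by lia.
      replace (S n * (k + 1))%nat with (S M) by lia.
      replace (S n * (S k + 1))%nat with (S M + S n)%nat by lia.
      rewrite pow_add. field. lra.
    - rewrite <- (Nat.div_unique M (S n) k (S M mod S n - 1)) by lia.
      unfold Rdiv. ring. }
  induction N as [|N IH].
  - rewrite sum_O, Hstep, Nat.Div0.div_0_l, Nat.add_0_l, Nat.mul_1_r by lia. reflexivity.
  - rewrite sum_Sn, IH, Hstep. unfold plus. cbn -[pow Nat.div Nat.mul]. field. lra.
Qed.

Definition lambert (q : R) : R := Series (fun n => q ^ S n / (1 - q ^ S n)).

Lemma lambert_term_bound (q : R) (n : nat) :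
  0 < q < 1 -> 0 < q ^ S n / (1 - q ^ S n) <= / (1 - q) * q ^ S n.
Proof.
  intros Hq. pose proof (pow_lt_1 q n Hq) as Hp.
  split; [apply Rdiv_lt_0_compat; lra|].
  unfold Rdiv. rewrite Rmult_comm. apply Rmult_le_compat_r; [lra|].
  apply Rinv_le_contravar; [lra|]. pose proof (pow_le_1 q n Hq). simpl. nra.
Qed.

Lemma is_series_lambert (q : R) :
  0 < q < 1 -> is_series (fun n => q ^ S n / (1 - q ^ S n)) (lambert q).
Proof.
  intros Hq. apply Series_correct.
  apply (ex_series_le (K := R_AbsRing) (V := R_CompleteNormedModule) _
           (fun n => / (1 - q) * q ^ S n)).
  - intro n. pose proof (lambert_term_bound q n Hq).
    change (Rabs (q ^ S n / (1 - q ^ S n)) <= / (1 - q) * q ^ S n).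
    rewrite Rabs_pos_eq; lra.
  - apply (ex_series_scal_l (K := R_AbsRing) (/ (1 - q)) (fun n => q ^ S n)).
    apply (ex_series_incr_1 (fun n => q ^ n)).
    exists (/ (1 - q)). apply is_series_geom. rewrite Rabs_pos_eq; lra.
Qed.

(* Truncating at [N], the divisor sum misses from each geometric series
   [q ^ n / (1 - q ^ n)] a tail of size at most [q ^ S N / (1 - q)]. *)
Lemma is_series_num_divisors (q : R) :
  0 < q < 1 -> is_series (fun n => INR (num_divisors (S n)) * q ^ S n) (lambert q).
Proof.
  intros Hq.
  set (L := fun N => sum_n (fun n => q ^ S n / (1 - q ^ S n)) N).
  set (D := fun N => sum_n (fun n => INR (num_divisors (S n)) * q ^ S n) N).
  assert (ED : forall N, D N = L N -
    sum_n (fun n => q ^ (S n * (S N / S n + 1)) / (1 - q ^ S n)) N).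
  { intro N.
    transitivity (sum_n (fun j => sum_n (fun i =>
      if (S j mod S i =? 0)%nat then q ^ S j else 0) N) N).
    - apply sum_n_ext_loc. intros j Hj. rewrite (num_divisors_sum j N Hj).
      rewrite Rmult_comm. symmetry.
      etransitivity; [|apply (sum_n_mult_l (K := R_Ring))].
      apply sum_n_ext. intro i. destruct (S j mod S i =? 0)%nat.
      + symmetry. apply Rmult_1_r.
      + symmetry. apply Rmult_0_r.
    (* After the exchange, the inner sum collects the multiples of a fixed divisor [S i]. *)
    - rewrite sum_n_switch. unfold L.
      assert (Hm : forall a b : nat -> R, sum_n a N - sum_n b N = sum_n (fun n => a n - b n) N).
      { intros a b. rewrite !sum_n_Reals. symmetry. apply minus_sum. }
      rewrite Hm. apply sum_n_ext. intro i. rewrite sum_multiples_pow by assumption.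
      pose proof (pow_lt_1 q i Hq). as_real_eq. field. lra. }
  assert (Herr : forall N,
    0 <= sum_n (fun n => q ^ (S n * (S N / S n + 1)) / (1 - q ^ S n)) N
      <= / (1 - q) * (INR (S N) * q ^ S N)).
  { intro N.
    assert (Hterm : forall n, 0 <= q ^ (S n * (S N / S n + 1)) / (1 - q ^ S n) <= / (1 - q) * q ^ S N).
    { intro n. pose proof (pow_lt_1 q n Hq) as Hp.
      assert (Hle : (S N <= S n * (S N / S n + 1))%nat).
      { pose proof (Nat.div_mod_eq (S N) (S n)).
        pose proof (Nat.mod_upper_bound (S N) (S n) ltac:(lia)). lia. }
      assert (Hpw : q ^ (S n * (S N / S n + 1)) <= q ^ S N).
      { replace (S n * (S N / S n + 1))%nat
          with (S N + (S n * (S N / S n + 1) - S N))%nat by lia.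
        rewrite pow_add. pose proof (pow_lt_1 q N Hq).
        pose proof (pow_le_1 q (S n * (S N / S n + 1) - S N) Hq). nra. }
      assert (0 < q ^ (S n * (S N / S n + 1))) by (apply pow_lt; lra).
      split; [apply Rlt_le, Rdiv_lt_0_compat; lra|].
      unfold Rdiv. rewrite Rmult_comm.
      apply Rmult_le_compat; [apply Rlt_le, Rinv_0_lt_compat; lra|lra| |exact Hpw].
      apply Rinv_le_contravar; [lra|]. pose proof (pow_le_1 q n Hq). simpl. nra. }
    split.
    - rewrite sum_n_Reals. apply cond_pos_sum. intro n. apply Hterm.
    - replace (/ (1 - q) * (INR (S N) * q ^ S N)) with (INR (S N) * (/ (1 - q) * q ^ S N)) by ring.
      rewrite <- (sum_n_const N (/ (1 - q) * q ^ S N)).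
      rewrite !sum_n_Reals. apply sum_Rle. intros n _. apply Hterm. }
  pose proof (is_series_lambert q Hq) as HL.
  change (is_lim_seq L (lambert q)) in HL.
  change (is_lim_seq D (lambert q)).
  apply (is_lim_seq_le_le (fun N => L N - / (1 - q) * (INR (S N) * q ^ S N)) _ L).
  - intro N. specialize (Herr N). rewrite ED. lra.
  - replace (lambert q) with (lambert q - / (1 - q) * 0) by ring.
    apply is_lim_seq_minus'; [exact HL|].
    apply (is_lim_seq_scal_l (fun N => INR (S N) * q ^ S N) _ 0).
    apply is_lim_seq_succ_mult_pow, Hq.
  - exact HL.
Qed.

(** * The double sum as a product, and its reduction to [gap] *)

(** Cauchy product of the divisor series and the logarithm series, both absolutely convergent
    because their terms are nonnegative. *)
Lemma is_series_double_sum (q : R) :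
  0 < q < 1 -> is_series (double_sum_term q) (lambert q * - ln (1 - q)).
Proof.
  intros Hq.
  assert (Habs : forall (a : nat -> R) l, (forall n, 0 <= a n) -> is_series a l ->
    ex_series (fun n => Rabs (a n))).
  { intros a l Ha Hl. exists l. apply (is_series_ext a); [|exact Hl].
    intro n. symmetry. apply Rabs_pos_eq, Ha. }
  pose proof (is_series_num_divisors q Hq) as H1.
  pose proof (is_series_neg_ln q Hq) as H2.
  eapply is_series_ext; [|apply (is_series_mult _ _ _ _ H1 H2)].
  - intro n. unfold double_sum_term.
    replace (n + 2 - 1)%nat with (S n) by lia.
    rewrite <- sum_n_m_S. change (sum_n_m ?f 0 n) with (sum_n f n).
    rewrite <- sum_n_Reals. apply sum_n_ext_loc. intros k Hk.
    replace (n + 2 - S k)%nat with (S (n - k)) by lia.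
    replace (n + 2)%nat with (S k + S (n - k))%nat by lia.
    rewrite pow_add. unfold Rdiv.
    as_real_eq. ring.
  - eapply Habs; [|exact H1]. intro n. pose proof (pow_lt_1 q n Hq).
    apply Rmult_le_pos; [apply pos_INR|lra].
  - eapply Habs; [|exact H2]. intro n. pose proof (pow_lt_1 q n Hq).
    apply Rlt_le, Rdiv_lt_0_compat; [lra|]. apply lt_0_INR. lia.
Qed.

Definition gap (q : R) : R := (1 - q) / q * (lambert q - ln (1 - q) / ln q).

(** The factor before [gap q + c] is positive and independent of [c], so each bound on the double
    sum is a bound on [gap q]. *)
Lemma Series_sub_log_bound (c q : R) : 0 < q < 1 ->
  Series (double_sum_term q) - log_bound c q
  = - ln (1 - q) * (q / (1 - q)) * (gap q + c).
Proof.
  intros Hq. rewrite (is_series_unique _ _ (is_series_double_sum q Hq)).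
  pose proof (ln_neg_of_lt_1 q Hq).
  unfold log_bound, gap. field. lra.
Qed.

Lemma log_bound_weight_pos (q : R) : 0 < q < 1 -> 0 < - ln (1 - q) * (q / (1 - q)).
Proof.
  intros Hq. pose proof (ln_neg_of_lt_1 (1 - q) ltac:(lra)).
  apply Rmult_lt_0_compat; [lra|]. apply Rdiv_lt_0_compat; lra.
Qed.

Lemma log_bound_lt_Series (c q : R) : 0 < q < 1 ->
  log_bound c q < Series (double_sum_term q) <-> - c < gap q.
Proof.
  intros Hq. pose proof (Series_sub_log_bound c q Hq) as E.
  pose proof (log_bound_weight_pos q Hq) as Hw. split; intros H; nra.
Qed.

Lemma Series_lt_log_bound (c q : R) : 0 < q < 1 ->
  Series (double_sum_term q) < log_bound c q <-> gap q < - c.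
Proof.
  intros Hq. pose proof (Series_sub_log_bound c q Hq) as E.
  pose proof (log_bound_weight_pos q Hq) as Hw. split; intros H; nra.
Qed.

(** Both series are combined termwise: at [u = - S n * ln q] one has [exp (- u) = q ^ S n], and
    [(1 - q) / q * q ^ S n] is the weight. *)
Lemma is_series_gap (q : R) : 0 < q < 1 ->
  is_series (fun n => (q ^ n - q ^ S n) * bose (INR (S n) * - ln q)) (gap q).
Proof.
  intros Hq. pose proof (ln_neg_of_lt_1 q Hq) as Hl.
  apply (is_series_ext (fun n => (1 - q) / q *
    (q ^ S n / (1 - q ^ S n) - / ln q * - (q ^ S n / INR (S n))))).
  - intro n. unfold bose. pose proof (pow_lt_1 q n Hq).
    pose proof (lt_0_INR (S n) ltac:(lia)).
    replace (exp (- (INR (S n) * - ln q))) with (q ^ S n).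
    2:{ rewrite <- Rpower_pow by lra. unfold Rpower. f_equal. ring. }
    replace (q ^ n) with (q ^ S n / q) by (simpl; field; lra).
    as_real_eq. field. repeat split; lra.
  - unfold gap. apply (is_series_scal_l (K := R_AbsRing) (V := R_NormedModule) ((1 - q) / q)).
    apply @is_series_minus; [apply is_series_lambert, Hq|].
    replace (ln (1 - q) / ln q) with (/ ln q * - - ln (1 - q)) by (field; lra).
    apply (is_series_scal_l (K := R_AbsRing) (V := R_NormedModule) (/ ln q)).
    apply @is_series_opp, is_series_neg_ln, Hq.
Qed.

(** * Series comparison and its consequences for [gap] *)

(** Strictness survives the limit because the partial sums stay at least [b 0 - a 0] apart. *)
Lemma is_series_lt (a b : nat -> R) (la lb : R) :
  is_series a la -> is_series b lb ->
  (forall n, a n <= b n) -> a 0%nat < b 0%nat -> la < lb.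
Proof.
  intros Ha Hb Hle Hlt.
  assert (Hsum : forall n, b 0%nat - a 0%nat <= sum_n b n - sum_n a n).
  { induction n as [|n IH]; [rewrite !sum_O; lra|].
    rewrite !sum_Sn. specialize (Hle (S n)).
    change (b 0%nat - a 0%nat <= sum_n b n + b (S n) - (sum_n a n + a (S n))). lra. }
  pose proof (is_lim_seq_le _ _ _ _ Hsum (is_lim_seq_const _)
                (is_lim_seq_minus' _ _ _ _ Hb Ha)) as H.
  simpl in H. lra.
Qed.

Lemma is_series_pairs (a : nat -> R) (l : R) :
  is_series a l -> is_series (fun n => a (2 * n)%nat + a (S (2 * n))) l.
Proof.
  intros Ha.
  change (is_lim_seq (sum_n (fun n => a (2 * n)%nat + a (S (2 * n)))) l).
  apply (is_lim_seq_ext (fun n => sum_n a (S (2 * n)))).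
  - induction n as [|n IH].
    + rewrite sum_Sn, !sum_O. reflexivity.
    + rewrite (sum_Sn (fun n => a (2 * n)%nat + a (S (2 * n)))), <- IH.
      replace (S (2 * S n)) with (S (S (S (2 * n)))) by lia.
      replace (2 * S n)%nat with (S (S (2 * n))) by lia.
      rewrite (sum_Sn a (S (S (2 * n)))), (sum_Sn a (S (2 * n))). apply (Rplus_assoc (sum_n a (S (2 * n)))).
  - apply (is_lim_seq_subseq (sum_n a)); [|exact Ha].
    apply eventually_subseq. intro n. lia.
Qed.

(** The weights in [is_series_gap] have total mass 1. *)
Lemma is_series_pow_diff (q : R) : 0 < q < 1 -> is_series (fun n => q ^ n - q ^ S n) 1.
Proof.
  intros Hq. pose proof (is_series_geom q ltac:(rewrite Rabs_pos_eq; lra)) as H.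
  replace 1 with ((1 - q) * / (1 - q)) by (field; lra).
  apply (is_series_ext (fun n => (1 - q) * q ^ n)); [intro n; simpl; ring|].
  apply (is_series_scal_l (K := R_AbsRing) (V := R_NormedModule) (1 - q)), H.
Qed.

Lemma pow_diff_pos (q : R) (n : nat) : 0 < q < 1 -> 0 < q ^ n - q ^ S n.
Proof. intros Hq. pose proof (pow_le_1 q n Hq). simpl. nra. Qed.

Lemma gap_arg_pos (q : R) (n : nat) : 0 < q < 1 -> 0 < INR (S n) * - ln q.
Proof.
  intros Hq. pose proof (ln_neg_of_lt_1 q Hq).
  apply Rmult_lt_0_compat; [apply lt_0_INR; lia|lra].
Qed.

Lemma gap_lt_1 (q : R) : 0 < q < 1 -> gap q < 1.
Proof.
  intros Hq.
  assert (Hn : forall n, (q ^ n - q ^ S n) * bose (INR (S n) * - ln q) < q ^ n - q ^ S n).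
  { intro n. pose proof (pow_diff_pos q n Hq).
    pose proof (bose_lt_1 _ (gap_arg_pos q n Hq)). nra. }
  apply (is_series_lt _ _ _ _ (is_series_gap q Hq) (is_series_pow_diff q Hq)).
  - intro n. apply Rlt_le, Hn.
  - apply Hn.
Qed.

(** Only the term of index 0 of the positive series is kept. As [q] tends to 0 the bound tends to 1,
    which makes the upper constant sharp. *)
Lemma gap_ge (q : R) : 0 < q < 1 -> 1 + (1 - q) / ln q <= gap q.
Proof.
  intros Hq. pose proof (ln_neg_of_lt_1 q Hq) as Hl.
  pose proof (is_lim_seq_incr_compare _ _ (is_series_gap q Hq)) as H.
  replace (1 + (1 - q) / ln q) with (sum_n (fun n => (q ^ n - q ^ S n) * bose (INR (S n) * - ln q)) 0).
  - apply H. intro n.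
    pose proof (Rmult_lt_0_compat _ _ (pow_diff_pos q (S n) Hq)
                  (bose_pos _ (gap_arg_pos q (S n) Hq))) as Hpos.
    rewrite sum_Sn. match goal with |- ?a <= plus ?a ?b => change (a <= a + b) end. lra.
  - rewrite sum_O. unfold bose. rewrite Rmult_1_l, Ropp_involutive, exp_ln by lra.
    simpl. field. lra.
Qed.

(* [gap q] is an upper Riemann-Stieltjes sum, with step [- ln q], of the increasing function [bose]
   against the measure of density [exp (- u)]; passing from [r ^ 2] to [r] halves the step. *)
Lemma gap_lt_gap_sqr (r : R) : 0 < r < 1 -> gap r < gap (r ^ 2).
Proof.
  intros Hr. assert (Hq : 0 < r ^ 2 < 1) by (apply (pow_lt_1 r 1 Hr)).
  (* Two neighbouring weights for [r] add up to one weight for [r ^ 2]. The second argument of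
     [bose] agrees with the one for [r ^ 2], and the first is smaller. *)
  assert (Hn : forall n,
    (r ^ (2 * n) - r ^ S (2 * n)) * bose (INR (S (2 * n)) * - ln r)
    + (r ^ S (2 * n) - r ^ S (S (2 * n))) * bose (INR (S (S (2 * n))) * - ln r)
    < ((r ^ 2) ^ n - (r ^ 2) ^ S n) * bose (INR (S n) * - ln (r ^ 2))).
  { intro n. rewrite ln_pow, <- !pow_mult by lra.
    replace (2 * S n)%nat with (S (S (2 * n))) by lia.
    replace (INR (S n) * - (INR 2 * ln r)) with (INR (S (S (2 * n))) * - ln r)
      by (rewrite !S_INR, mult_INR; simpl; ring).
    pose proof (pow_diff_pos r (2 * n) Hr) as Hp.
    assert (Hb : bose (INR (S (2 * n)) * - ln r) < bose (INR (S (S (2 * n))) * - ln r)).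
    { apply bose_increasing; [apply gap_arg_pos, Hr|].
      rewrite (S_INR (S (2 * n))). pose proof (ln_neg_of_lt_1 r Hr). lra. }
    nra. }
  apply (is_series_lt _ _ _ _ (is_series_pairs _ _ (is_series_gap r Hr)) (is_series_gap _ Hq)).
  - intro n. apply Rlt_le, Hn.
  - apply (Hn 0%nat).
Qed.

(** * The limit of [gap] at 1 *)

(** Apply [1 - 1/x <= ln x <= x - 1] at [(1 - y * q) / (1 - y)] and at [q]. For [y = q ^ n] the
    outer members are consecutive terms of the Lambert series. *)
Lemma ln_one_sub_step_bounds (q y : R) : 0 < q < 1 -> 0 < y < 1 ->
  y * q / (1 - y * q) <= (ln (1 - y * q) - ln (1 - y)) / - ln q <= y / (1 - y).
Proof.
  intros Hq Hy. pose proof (ln_neg_of_lt_1 q Hq) as Hl.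
  assert (Hyq : 0 < y * q < 1) by nra.
  pose proof (ln_le_sub_1 q ltac:(lra)) as Hq1.
  pose proof (ln_ge_1_sub_inv q ltac:(lra)) as Hq2.
  assert (Hr : 0 < (1 - y * q) / (1 - y)) by (apply Rdiv_lt_0_compat; lra).
  rewrite <- ln_div by lra. split.
  - apply Rmult_le_reg_r with (- ln q); [lra|].
    replace (ln ((1 - y * q) / (1 - y)) / - ln q * - ln q)
      with (ln ((1 - y * q) / (1 - y))) by (field; lra).
    eapply Rle_trans; [|apply ln_ge_1_sub_inv, Hr].
    replace (1 - / ((1 - y * q) / (1 - y))) with (y * q / (1 - y * q) * (/ q - 1)) by (field; lra).
    apply Rmult_le_compat_l; [|lra]. apply Rlt_le, Rdiv_lt_0_compat; lra.
  - apply Rmult_le_reg_r with (- ln q); [lra|].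
    replace (ln ((1 - y * q) / (1 - y)) / - ln q * - ln q)
      with (ln ((1 - y * q) / (1 - y))) by (field; lra).
    eapply Rle_trans; [apply ln_le_sub_1, Hr|].
    replace ((1 - y * q) / (1 - y) - 1) with (y / (1 - y) * (1 - q)) by (field; lra).
    apply Rmult_le_compat_l; [|lra]. apply Rlt_le, Rdiv_lt_0_compat; lra.
Qed.

Lemma sum_n_pow (q : R) (N : nat) : q <> 1 ->
  sum_n (fun i => q ^ i) N = (1 - q ^ S N) / (1 - q).
Proof. intros Hq. rewrite sum_n_Reals. apply tech3, Hq. Qed.

(** A truncation of [gap] in which each [1 - q ^ n] is divided by [1 - q], so that every factor has
    a limit as [q] tends to 1. *)
Definition gap_partial (q : R) (N : nat) : R :=
  sum_n (fun n => q ^ n / sum_n (fun i => q ^ i) n) N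
  - (1 - q) / q / - ln q * ln (sum_n (fun i => q ^ i) (S N)).

Lemma gap_partial_eq (q : R) (N : nat) : 0 < q < 1 ->
  gap_partial q N = (1 - q) / q * (sum_n (fun n => q ^ S n / (1 - q ^ S n)) N
    - (ln (1 - q ^ S (S N)) - ln (1 - q)) / - ln q).
Proof.
  intros Hq. pose proof (ln_neg_of_lt_1 q Hq). pose proof (pow_lt_1 q (S N) Hq).
  unfold gap_partial. rewrite sum_n_pow, ln_div by lra.
  rewrite (sum_n_ext _ (fun n => (1 - q) / q * (q ^ S n / (1 - q ^ S n)))).
  - rewrite (sum_n_mult_l (K := R_Ring)). rewrite (Rmult_minus_distr_l ((1 - q) / q)).
    apply f_equal2; [reflexivity|]. field. lra.
  - intro n. pose proof (pow_lt_1 q n Hq). rewrite sum_n_pow by lra.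
    replace (q ^ n) with (q ^ S n / q) by (simpl; field; lra).
    as_real_eq. field. lra.
Qed.

(* The increments of [gap_partial q] are nonnegative and telescope against
   [q ^ S n / (1 - q ^ S n)]. *)
Lemma gap_partial_bounds (q : R) (N : nat) : 0 < q < 1 ->
  gap_partial q N <= gap q <= gap_partial q N + / INR (S (S N)).
Proof.
  intros Hq. pose proof (ln_neg_of_lt_1 q Hq) as Hl.
  set (f := fun n => q ^ S n / (1 - q ^ S n)).
  assert (Hc : 0 < (1 - q) / q) by (apply Rdiv_lt_0_compat; lra).
  assert (Hf : is_lim_seq (sum_n f) (lambert q)) by exact (is_series_lambert q Hq).
  assert (Hpow : is_lim_seq (fun n => q ^ n) 0)
    by (apply is_lim_seq_geom; rewrite Rabs_pos_eq; lra).
  assert (Hlim : is_lim_seq (gap_partial q) (gap q)).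
  { apply (is_lim_seq_ext (fun N => (1 - q) / q *
      (sum_n f N - (ln (1 - q ^ S (S N)) - ln (1 - q)) * / - ln q))).
    { intro n. rewrite gap_partial_eq by assumption. reflexivity. }
    unfold gap. apply (is_lim_seq_scal_l _ ((1 - q) / q) (lambert q - ln (1 - q) / ln q)).
    apply is_lim_seq_minus'; [exact Hf|].
    replace (ln (1 - q) / ln q) with ((0 - ln (1 - q)) * / - ln q) by (field; lra).
    apply (is_lim_seq_scal_r _ (/ - ln q) (0 - ln (1 - q))).
    apply is_lim_seq_minus'; [|apply is_lim_seq_const].
    rewrite <- ln_1. apply (is_lim_seq_continuous ln (fun n => 1 - q ^ S (S n)) 1).
    { apply derivable_continuous_pt. exists (/ 1). apply derivable_pt_lim_ln. lra. }
    replace (Finite 1) with (Finite (1 - 0)) by (f_equal; ring).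
    apply is_lim_seq_minus'; [apply is_lim_seq_const|].
    apply (is_lim_seq_incr_n (fun n => q ^ n) 2) in Hpow.
    apply (is_lim_seq_ext (fun n => q ^ (n + 2))); [|exact Hpow].
    intro n. f_equal. lia. }
  assert (Hstep : forall n, gap_partial q (S n) - gap_partial q n = (1 - q) / q *
    (f (S n) - (ln (1 - q ^ S (S n) * q) - ln (1 - q ^ S (S n))) / - ln q)).
  { intro n. rewrite !gap_partial_eq, sum_Sn by assumption.
    replace (q ^ S (S n) * q) with (q ^ S (S (S n))) by (simpl; ring).
    unfold plus, f. cbn -[pow sum_n]. field. 
    pose proof (pow_lt_1 q (S n) Hq). lra. }
  assert (Hfs : forall n, f (S n) = q ^ S n * q / (1 - q ^ S n * q)).
  { intro n. unfold f. replace (q ^ S (S n)) with (q ^ S n * q) by (simpl; ring). reflexivity. }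
  pose proof (fun n => ln_one_sub_step_bounds q (q ^ S n) Hq (pow_lt_1 q n Hq)) as Hln.
  split.
  - apply (is_lim_seq_incr_compare _ _ Hlim). intro n.
    pose proof (Hstep n). destruct (Hln (S n)) as [_ H1].
    change (q ^ S (S n) / (1 - q ^ S (S n))) with (f (S n)) in H1. nra.
  (* Adding the next Lambert term yields a decreasing sequence with the same limit. *)
  - assert (Hg : is_lim_seq (fun n => gap_partial q n + (1 - q) / q * f (S n)) (gap q)).
    { replace (gap q) with (gap q + (1 - q) / q * 0) by ring.
      apply is_lim_seq_plus'; [exact Hlim|].
      apply (is_lim_seq_scal_l _ _ 0).
      apply (is_lim_seq_incr_1 f).
      apply (ex_series_lim_0 f). exists (lambert q). exact Hf. }
    eapply Rle_trans; [apply (is_lim_seq_decr_compare _ _ Hg)|].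
    + intro n. pose proof (Hstep n). destruct (Hln (S n)) as [H1 _].
      rewrite <- Hfs in H1. nra.
    (* The added term is at most [/ INR (S (S N))] uniformly in [q], so [q] may tend to 1 with [N]
       fixed. *)
    + apply Rplus_le_compat_l.
      pose proof (pow_mult_succ_le q (S N) Hq) as Hp.
      pose proof (pow_lt_1 q (S N) Hq) as Hp1.
      pose proof (lt_0_INR (S (S N)) ltac:(lia)) as Hi.
      unfold f. apply Rmult_le_reg_r with (INR (S (S N)) * (1 - q ^ S (S N))).
      { apply Rmult_lt_0_compat; lra. }
      replace (/ INR (S (S N)) * (INR (S (S N)) * (1 - q ^ S (S N)))) with (1 - q ^ S (S N))
        by (field; lra).
      replace ((1 - q) / q * (q ^ S (S N) / (1 - q ^ S (S N))) * (INR (S (S N)) * (1 - q ^ S (S N))))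
        with (INR (S (S N)) * q ^ S N * (1 - q)).
      2:{ replace (q ^ S N) with (q ^ S (S N) / q) by (simpl; field; lra). field. lra. }
      exact Hp.
Qed.

Lemma is_lim_seq_sum_n (a : nat -> nat -> R) (l : nat -> R) (N : nat) :
  (forall n, is_lim_seq (fun k => a k n) (l n)) ->
  is_lim_seq (fun k => sum_n (a k) N) (sum_n l N).
Proof.
  intros H. induction N as [|N IH].
  - rewrite sum_O. apply (is_lim_seq_ext (fun k => a k 0%nat)); [|apply H].
    intro k. rewrite sum_O. reflexivity.
  - rewrite sum_Sn. apply (is_lim_seq_ext (fun k => sum_n (a k) N + a k (S N))).
    { intro k. rewrite sum_Sn. reflexivity. }
    apply is_lim_seq_plus'; [exact IH|apply H].
Qed.

Lemma is_lim_seq_gap_partial (u : nat -> R) (N : nat) :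
  (forall k, 0 < u k < 1) -> is_lim_seq u 1 ->
  is_lim_seq (fun k => gap_partial (u k) N)
    (sum_n (fun n => / INR (S n)) N - ln (INR (S (S N)))).
Proof.
  intros Hu Hlim.
  assert (Hpow : forall n, is_lim_seq (fun k => u k ^ n) 1).
  { intro n. rewrite <- (pow1 n).
    apply (is_lim_seq_continuous (fun x => x ^ n) u 1); [|exact Hlim].
    apply derivable_continuous_pt, derivable_pt_pow. }
  assert (Hgeo : forall n, is_lim_seq (fun k => sum_n (fun i => u k ^ i) n) (INR (S n))).
  { intro n. replace (INR (S n)) with (sum_n (fun _ => 1) n).
    - apply (is_lim_seq_sum_n (fun k i => u k ^ i)), Hpow.
    - rewrite sum_n_const. apply Rmult_1_r. }
  assert (Hpos : forall n, 0 < INR (S n)) by (intro n; apply lt_0_INR; lia).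
  assert (Hinv : is_lim_seq (fun k => / u k) 1).
  { replace (Finite 1) with (Rbar_inv 1) by (simpl; f_equal; field).
    apply is_lim_seq_inv; [exact Hlim|]. intro E. injection E. lra. }
  apply is_lim_seq_minus'.
  - apply (is_lim_seq_sum_n (fun k n => u k ^ n / sum_n (fun i => u k ^ i) n)). intro n.
    replace (/ INR (S n)) with (1 / INR (S n)) by (field; specialize (Hpos n); lra).
    apply is_lim_seq_div'; [apply Hpow|apply Hgeo|]. specialize (Hpos n). lra.
  - rewrite <- (Rmult_1_l (ln (INR (S (S N))))).
    apply is_lim_seq_mult'.
    (* The logarithm bounds squeeze [(1 - u) / (- u ln u)] between 1 and [1 / u]. *)
    + apply (is_lim_seq_le_le (fun _ => 1) _ (fun k => / u k)); [|apply is_lim_seq_const|exact Hinv].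
      intro k. specialize (Hu k). pose proof (ln_neg_of_lt_1 _ Hu).
      pose proof (ln_le_sub_1 (u k) ltac:(lra)). pose proof (ln_ge_1_sub_inv (u k) ltac:(lra)).
      split.
      * apply Rmult_le_reg_r with (- ln (u k)); [lra|].
        replace ((1 - u k) / u k / - ln (u k) * - ln (u k)) with (/ u k - 1) by (field; lra).
        lra.
      * apply Rmult_le_reg_r with (- ln (u k) * u k); [nra|].
        replace ((1 - u k) / u k / - ln (u k) * (- ln (u k) * u k)) with (1 - u k) by (field; lra).
        replace (/ u k * (- ln (u k) * u k)) with (- ln (u k)) by (field; lra).
        lra.
    + apply (is_lim_seq_continuous ln); [|apply Hgeo].
      apply derivable_continuous_pt. exists (/ INR (S (S N))).
      apply derivable_pt_lim_ln, Hpos.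
Qed.

Lemma is_lim_seq_gap (u : nat -> R) :
  (forall k, 0 < u k < 1) -> is_lim_seq u 1 ->
  is_lim_seq (fun k => gap (u k)) euler_gamma.
Proof.
  intros Hu Hlim. apply is_lim_seq_spec. intro eps.
  assert (Heps : 0 < eps / 3) by (pose proof (cond_pos eps); lra).
  set (e := mkposreal _ Heps).
  assert (HI : is_lim_seq (fun n => / INR n) 0).
  { apply (is_lim_seq_inv INR p_infty); [apply is_lim_seq_INR|discriminate]. }
  destruct (proj2 (is_lim_seq_spec _ _) is_lim_seq_euler_gamma e) as [N1 H1].
  destruct (proj2 (is_lim_seq_spec _ _) HI e) as [N2 H2].
  (* [N] is fixed before [k]. The three errors are the distance of the harmonic sequence from its
     limit, the last harmonic term [/ INR (S (S N))], and the convergence of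
     [gap_partial (u k) N]. *)
  set (N := (N1 + N2)%nat).
  specialize (H1 (S (S N)) ltac:(lia)). specialize (H2 (S (S N)) ltac:(lia)).
  destruct (proj2 (is_lim_seq_spec _ _) (is_lim_seq_gap_partial u N Hu Hlim) e) as [K HK].
  exists K. intros k Hk. specialize (HK k Hk).
  pose proof (gap_partial_bounds (u k) N (Hu k)) as HB.
  rewrite <- sum_n_m_S in H1. change (sum_n_m ?f 0 (S N)) with (sum_n f (S N)) in H1.
  rewrite sum_Sn in H1.
  change (Rabs (sum_n (fun n => / INR (S n)) N + / INR (S (S N)) - ln (INR (S (S N)))
                - euler_gamma) < eps / 3) in H1.
  change (Rabs (/ INR (S (S N)) - 0) < eps / 3) in H2.
  change (Rabs (gap_partial (u k) N - (sum_n (fun n => / INR (S n)) N - ln (INR (S (S N)))))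
          < eps / 3) in HK.
  apply Rabs_def2 in H1. apply Rabs_def2 in H2. apply Rabs_def2 in HK.
  apply Rabs_def1; lra.
Qed.

(** * The lower bound along iterated square roots *)

Definition root_seq (q : R) (k : nat) : R := exp (ln q / 2 ^ k).

Lemma root_seq_interval (q : R) (k : nat) : 0 < q < 1 -> 0 < root_seq q k < 1.
Proof.
  intros Hq. unfold root_seq. pose proof (ln_neg_of_lt_1 q Hq) as Hl.
  pose proof (pow_lt 2 k ltac:(lra)).
  replace (ln q / 2 ^ k) with (- (- ln q / 2 ^ k)) by (field; lra).
  apply exp_neg_interval, Rdiv_lt_0_compat; lra.
Qed.

Lemma root_seq_sqr (q : R) (k : nat) : root_seq q (S k) ^ 2 = root_seq q k.
Proof.
  unfold root_seq. pose proof (pow_lt 2 k ltac:(lra)).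
  simpl (_ ^ 2). rewrite Rmult_1_r, <- exp_plus. f_equal. simpl. field. lra.
Qed.

Lemma is_lim_seq_root_seq (q : R) : is_lim_seq (root_seq q) 1.
Proof.
  rewrite <- exp_0. apply (is_lim_seq_continuous exp (fun k => ln q / 2 ^ k) 0).
  { apply derivable_continuous_pt, derivable_pt_exp. }
  replace (Finite 0) with (Finite (ln q * 0)) by (f_equal; ring).
  apply (is_lim_seq_scal_l (fun k => / 2 ^ k) (ln q) 0).
  apply (is_lim_seq_ext (fun k => (/ 2) ^ k)); [intro k; apply pow_inv|].
  apply is_lim_seq_geom. rewrite Rabs_pos_eq; lra.
Qed.

Lemma gap_gt_euler_gamma (q : R) : 0 < q < 1 -> euler_gamma < gap q.
Proof.
  intros Hq.
  assert (Hdecr : forall k, gap (root_seq q (S k)) < gap (root_seq q k)).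
  { intro k. rewrite <- (root_seq_sqr q k). apply gap_lt_gap_sqr, root_seq_interval, Hq. }
  (* The limit is compared with index 1, not 0; the strict step from index 1 to index 0 then gives
     strict inequality at [q]. *)
  pose proof (is_lim_seq_decr_compare _ _
    (is_lim_seq_gap _ (fun k => root_seq_interval q k Hq) (is_lim_seq_root_seq q))
    (fun k => Rlt_le _ _ (Hdecr k)) 1%nat) as H.
  specialize (Hdecr 0%nat). simpl in H.
  replace (root_seq q 0) with q in Hdecr; [lra|].
  unfold root_seq. simpl. rewrite Rdiv_1_r. symmetry. apply exp_ln. lra.
Qed.

(** * Both inequalities and the optimality of their constants *)

Theorem theorem4p4 :
  (forall q : R, 0 < q < 1 ->
     ex_series (double_sum_term q) /\
     log_bound (- euler_gamma) q < Series (double_sum_term q) < log_bound (-1) q) /\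
  (forall lambda0 mu0 : R,
     (forall q : R, 0 < q < 1 ->
        log_bound lambda0 q < Series (double_sum_term q) < log_bound mu0 q) ->
     lambda0 >= - euler_gamma /\ mu0 <= -1).
Proof.
  split.
  - intros q Hq. split; [eexists; apply is_series_double_sum, Hq|].
    rewrite log_bound_lt_Series, Series_lt_log_bound by assumption.
    pose proof (gap_gt_euler_gamma q Hq). pose proof (gap_lt_1 q Hq). lra.
  - intros lambda0 mu0 H. split.
    (* Any sequence tending to 1 would serve; the iterated roots of [/ 2] are one. *)
    + assert (Hq : 0 < / 2 < 1) by lra.
      pose proof (is_lim_seq_gap _ (fun k => root_seq_interval (/ 2) k Hq)
                    (is_lim_seq_root_seq (/ 2))) as Hlim.
      enough (Hle : Rbar_le (- lambda0) euler_gamma) by (simpl in Hle; lra).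
      apply (is_lim_seq_le (fun _ => - lambda0) _ _ _) with (2 := is_lim_seq_const _) (3 := Hlim).
      intro k. pose proof (root_seq_interval (/ 2) k Hq) as Hk.
      apply Rlt_le, log_bound_lt_Series, H; assumption.
    + destruct (Rle_lt_dec mu0 (-1)) as [Hle|Hlt]; [exact Hle|exfalso].
      (* At [q = exp (- T)], [gap_ge] gives [gap q >= 1 - (1 - q) * (mu0 + 1) > - mu0], against the
         assumed upper bound. *)
      set (T := / (mu0 + 1)).
      assert (HT : 0 < T) by (apply Rinv_0_lt_compat; lra).
      pose proof (exp_neg_interval T HT) as Hq.
      pose proof (proj1 (Series_lt_log_bound _ _ Hq) (proj2 (H _ Hq))) as H1.
      pose proof (gap_ge _ Hq) as H2. rewrite ln_exp in H2.
      replace ((1 - exp (- T)) / - T) with (- ((1 - exp (- T)) * (mu0 + 1))) in H2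
        by (unfold T; field; lra).
      nra.
Qed.
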